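(* Let $\mathcal{C}=\{\varphi_k \mid k\in\mathcal{K}\}$ be a regularity based (rb) block cipher over $\mathbb{F}_p$ with message space $V=V_1\times\cdots\times V_n$, with respect to the operations $\Box_1,\dots,\Box_n$, and let $h_0$ be a round index such that the map $\mathcal{K}\to V$, $k\mapsto\phi(k,h_0)$, is surjective. Write $\gamma=\gamma_{h_0}=(\gamma_1,\dots,\gamma_n)$ for the bricklayer transformation of round $h_0$, with bricks $\gamma_i\in\mathrm{Sym}(V_i)$. If $\gamma_i$ is anti-crooked with respect to $\Box_i$ for every $i\in\{1,\dots,n\}$, then $\Gamma_{h_0}(\mathcal{C})$ and $\Gamma_\infty(\mathcal{C})$ are not contained in any copy of the affine group in $\mathrm{Sym}(V)$.
   Context: Let $p$ be a prime and $V=(\mathbb{F}_p)^d$. Copies of the affine group: for any operation $\circ$ making the set $V$ the additive group of an $\mathbb{F}_p$-vector space $(V,\circ)$, $\mathrm{AGL}(V,\circ)\le\mathrm{Sym}(V)$ is the group of maps $x\mapsto g(x)\circ v$ with $g\in\mathrm{GL}(V,\circ)$, $v\in V$. These groups (the conjugates of $\mathrm{AGL}(V)$ in $\mathrm{Sym}(V)$) are the copies of the affine group in $\mathrm{Sym}(V)$. Block cipher: $\mathcal{C}=\{\varphi_k\mid k\in\mathcal{K}\}\subseteq \mathrm{Sym}(V)$, with $\mathcal{K}$ the key space; each $\varphi_k$ is the composition of $l$ round functions $\varphi_{k,1},\dots,\varphi_{k,l}\in\mathrm{Sym}(V)$. Put $\Gamma_h(\mathcal{C})=\langle\varphi_{k,h}\mid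 k\in\mathcal{K}\rangle$ and $\Gamma_\infty(\mathcal{C})=\langle\varphi_{k,h}\mid k\in\mathcal{K},\ h=1,\dots,l\rangle$. Decomposition and key action: $V=V_1\times\cdots\times V_n$ with $n>1$, the $V_i$ subspaces of $V$ with $\dim_{\mathbb{F}_p}(V_i)=m>1$ for all $i$, so $d=mn$. $T=T_1\times\cdots\times T_n$ is an abelian subgroup of $\Gamma_\infty(\mathcal{C})$ (acting componentwise on $V$) such that each $T_i\le\mathrm{Sym}(V_i)$ is abelian and regular on $V_i$. For $v\in V_i$ let $\sigma_{i,v}$ be the unique element of $T_i$ with $\sigma_{i,v}(0)=v$, and set $x\,\Box_i\,v=\sigma_{i,v}(x)$ for $x,v\in V_i$; then $(V_i,\Box_i)$ is an abelian group with identity $0$, isomorphic to $T_i$. On $V$ put $w\,\Box\,v=(w_1\Box_1v_1,\dots,w_n\Box_nv_n)$ and $\sigma_v(w)=w\,\Box\,v$, so that $T=\{\sigma_v\mid v\in V\}$. Bricklayer transformation: $\gamma\in\mathrm{Sym}(V)$ such that $\gamma(v_1,\dots,v_n)=(\gamma_1(v_1),\dots,\gamma_n(v_n))$ for some $\gamma_i\in\mathrm{Sym}(V_i)$, called bricks. Regularity based (rb) cipher: $\mathcal{C}$ is rb if each round function can be written as $\varphi_{k,h}=\sigma_{\phi(k,h)}\lambda_h\gamma_h$ (composition of maps, $\gamma_h$ applied first), where: $\gamma_h$ is a bricklayer transformation not depending on $k$ with $\gamma_h(0)=0$; $\lambda_h$ is a group automorphism of $(V,\Box)$ not depending on $k$;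 $\phi:\mathcal{K}\times\{1,\dots,l\}\to V$ is the key scheduling function; and for at least one round index $h_0$ the map $\mathcal{K}\to V$, $k\mapsto\phi(k,h_0)$, is surjective. Anti-crooked: a permutation $\rho\in\mathrm{Sym}(V_i)$ is anti-crooked (AC) with respect to $\Box_i$ if for each $a\in V_i\setminus\{0\}$ the set $\{\rho(x\,\Box_i\,a)\boxminus_i\rho(x)\mid x\in V_i\}$ is not a coset of a subgroup of $(V_i,\Box_i)$, where $y\boxminus_i z$ denotes $y\,\Box_i\,z'$ with $z'$ the $\Box_i$-inverse of $z$. *)

(* Defs.v *)
From HB Require Import structures.
From mathcomp Require Import all_boot all_order all_fingroup all_algebra.
From mathcomp Require Import boolp.

Set Implicit Arguments.
Unset Strict Implicit.
Unset Printing Implicit Defensive.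

Import GRing.Theory.
Local Open Scope ring_scope.

HB.instance Definition _ (K : finFieldType) (d : nat)
    (U : {vspace 'rV[K]_d}) := [Countable of subvs_of U by <:].
HB.instance Definition _ (K : finFieldType) (d : nat)
    (U : {vspace 'rV[K]_d}) := [Finite of subvs_of U by <:].

Section Operation.
Variables (X : finType) (op : X -> X -> X) (e : X).

Definition op_inv (z : X) : X := odflt e [pick z' | op z z' == e].

Definition op_subgroup (H : {set X}) : Prop :=
  [/\ e \in H,
      {in H &, forall x y, op x y \in H} &
      {in H, forall x, op_inv x \in H}].

Definition op_coset (S : {set X}) : Prop :=
  exists (H : {set X}) (a : X), op_subgroup H /\ S = [set op a x | x in H].

Definition anti_crooked (rho : {perm X}) : Prop :=
  forall a : X, a != e ->
    ~ op_coset [set op (rho (op x a)) (op_inv (rho x)) | x : X].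

End Operation.

Section Regular.
Variables (X : finType) (T : {set {perm X}}) (o : X).

Definition regular : Prop :=
  [transitive T, on [set: X] | 'P] /\ (forall x : X, 'C_T[x | 'P]%g = 1%g).

(* For [T] regular, the element picked is unique; the default 1 is not used. *)
Definition translation (v : X) : {perm X} :=
  odflt 1%g [pick s in T | s o == v].

Definition box (x v : X) : X := translation v x.

End Regular.

(* [c] is an F_p-vector space structure whose carrier is [X] itself, and
   [GRing.Lmodule.Pack c] is the set [X] endowed with this structure. *)
Definition AGL (p : nat) (X : finType) (c : GRing.Lmodule 'F_p X) :
    {set {perm X}} :=
  let L : lmodType 'F_p := GRing.Lmodule.Pack c in
  [set s : {perm X} | `[< exists (g : {linear L -> L}) (v : L),
      bijective g /\ forall x : L, (s : L -> L) x = g x + v >] ].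

(* The product of permutations applies its left factor first, so the rounds
   are performed in increasing order of their indices. *)
Record block_cipher (K : Type) (X : finType) := BlockCipher {
  rounds : nat;
  encryption : K -> {perm X};
  round_fun : K -> 'I_rounds -> {perm X};
  encryptionE : forall k,
    encryption k = (\prod_(h < rounds) round_fun k h)%g
}.

Section Gamma.
Variables (K : Type) (X : finType) (C : block_cipher K X).

Definition Gamma_round (h : 'I_(rounds C)) : {group {perm X}} :=
  <<[set s | `[< exists k, s = round_fun k h >]]>>%G.

Definition Gamma_inf : {group {perm X}} :=
  <<[set s | `[< exists k (h : 'I_(rounds C)), s = round_fun k h >]]>>%G.

End Gamma.

Section Decomposition.
Variables (p d n : nat).
Local Notation V := 'rV['F_p]_d.
Variable V_ : 'I_n -> {vspace V}.

Definition decomposition (m : nat) : Prop :=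
  [/\ directv (\sum_i V_ i),
      (\sum_i V_ i)%VS = fullv &
      forall i, \dim (V_ i) = m].

(* When the sum of the [V_ j] is direct and full, this is the projection onto
   [V_ i] along the sum of the other summands. *)
Definition component (i : 'I_n) (v : V) : subvs_of (V_ i) :=
  vsproj (V_ i) (sumv_pi (\sum_(j < n) V_ j)%VS i v).

Definition of_components (w : forall i, subvs_of (V_ i)) : V :=
  \sum_(i < n) vsval (w i).

Definition componentwise (f : forall i, subvs_of (V_ i) -> subvs_of (V_ i))
    (v : V) : V :=
  of_components (fun i => f i (component i v)).

Variable T_ : forall i, {group {perm subvs_of (V_ i)}}.

Definition prod_group : {set {perm V}} :=
  [set s : {perm V} | `[< exists t : forall i, {perm subvs_of (V_ i)},
      (forall i, t i \in T_ i) /\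
      (forall v, s v = componentwise (fun i => t i) v) >] ].

Definition boxi (i : 'I_n) : subvs_of (V_ i) -> subvs_of (V_ i) ->
    subvs_of (V_ i) := box (T_ i) 0.

Definition boxV (w v : V) : V :=
  of_components (fun i => boxi (component i w) (component i v)).

Definition key_action (K : Type) (C : block_cipher K V) : Prop :=
  [/\ forall i, abelian (T_ i),
      forall i, regular (T_ i),
      group_set prod_group,
      abelian prod_group &
      prod_group \subset Gamma_inf C].

Record rb_cipher (K : Type) (C : block_cipher K V) := RbCipher {
  gamma : 'I_(rounds C) -> {perm V};
  brick : 'I_(rounds C) -> forall i, {perm subvs_of (V_ i)};
  lambda : 'I_(rounds C) -> {perm V};
  key_sched : K -> 'I_(rounds C) -> V;
  rb_key_action : key_action C;
  rb_bricklayer : forall h v,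
    gamma h v = componentwise (fun i => brick h i) v;
  rb_gamma0 : forall h, gamma h 0 = 0;
  rb_automorphism : forall h, {morph lambda h : w v / boxV w v};
  (* [boxV ^~ v] is the key action sigma_v. *)
  rb_round : forall k h x,
    round_fun k h x = boxV (lambda h (gamma h x)) (key_sched k h);
  rb_surjective : exists h, forall v, exists k, key_sched k h = v
}.

End Decomposition.

(* Main.v *)
Require Import Defs.
From mathcomp Require Import all_boot all_order all_fingroup all_algebra.
From mathcomp Require Import all_solvable.
From mathcomp Require Import boolp.

Set Implicit Arguments.
Unset Strict Implicit.
Unset Printing Implicit Defensive.

Import GRing.Theory.
Local Open Scope ring_scope.

(** Let [N] be the group of translations of a vector space structure on [V] and
    suppose that its affine group contains the group of the round. That group
    contains the key action [T] and the keyless round [rho], which is [gamma]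
    followed by [lambda]; hence [T] and [rho] normalise [N]. Both [N] and [T]
    are abelian and regular on [V], so both are p-groups; the rest is an
    argument about two abelian regular groups, one normalising the other.

    The p-group generated by [N] and [T] has a central element [tau <> 1] in
    its normal subgroup [N]. Being regular and abelian, [T] is its own
    centraliser, so [tau] belongs to [T] too: it is the key action of
    some [a <> 0]. Hence passing from [rho x] to the image under [rho] of
    [x] boxed with [a] is applying the element [theta = tau ^ rho] of [N], and
    the derivative of [rho] in direction [a] takes on the values
    [(theta ^ t) 0], for [t] in [T]. Since [theta ^ t = theta * [~ theta, t]],
    it is enough to know that the commutators [[~ theta, t]] form a subgroup
    normalised by [T] ([group_set_commutators]). That follows from a symmetry
    ([commg_swap]) that exchanges the roles of the two groups: the commutators
    are also the [[~ n, s]] for [n] in [N] and one fixed [s] in [T], the values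
    of a homomorphism. Therefore the derivative of [rho] in direction [a] is
    a coset of a subgroup of [V] under the box operation
    ([normaliser_derivative_coset]).

    Some component of [a] is nonzero, say the one of index [i]. The inverse of
    [lambda] and the projection to the component [i] are homomorphisms for the
    box operations, and together they map the derivative of [rho] onto a
    derivative of the brick of index [i], which is thus a coset as well
    ([brick_derivative_coset]). This contradicts anti-crookedness. *)

(** * The operation of an abelian regular permutation group *)

Section RegularGroup.
Local Open Scope group_scope.
Variables (X : finType) (T : {group {perm X}}).
Hypothesis regT : regular T.

Lemma regular_inj x : {in T &, injective (fun s : {perm X} => s x)}.
Proof.
move=> s t sT tT /= st; have [_ stT] := regT.
have : s * t^-1 \in 'C_T[x | 'P].
  by rewrite inE groupM ?groupV //; apply/astab1P; rewrite /= apermE permM st permK.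
by rewrite stT => /set1P/(canRL (mulgKV _)); rewrite mul1g.
Qed.

Lemma regular_trans x y : exists2 s, s \in T & s x = y.
Proof.
have [trT _] := regT.
have /orbitP[s sT sx] : y \in orbit 'P T x by rewrite (atransP trT) inE.
by exists s.
Qed.

Lemma card_regular (o : X) : #|T| = #|X|.
Proof.
have [trT stT] := regT.
by rewrite -(card_orbit_stab 'P T o) (atransP trT) ?inE // stT cards1 muln1 cardsT.
Qed.

(** A permutation that commutes with a regular abelian group agrees with an
    element of the group at one point, hence, by transitivity, everywhere. *)
Lemma regular_abelian_self_centralising (o : X) :
  abelian T -> 'C(T) \subset T.
Proof.
move=> cTT; apply/subsetP => s /centP cs.
have [t tT to] := regular_trans o (s o).
suff -> : s = t by [].
apply/permP => x; have [u uT <-] := regular_trans o x.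
by rewrite -!permM -(cs _ uT) (centsP cTT _ uT _ tT) !permM to.
Qed.

Variable o : X.

Lemma translation_spec v : translation T o v \in T /\ translation T o v o = v.
Proof.
rewrite /translation; case: pickP => [s /andP[sT /eqP so] //|noT].
by have [s sT so] := regular_trans o v; have := noT s; rewrite sT so eqxx.
Qed.

Lemma translation_mem v : translation T o v \in T.
Proof. by case: (translation_spec v). Qed.

Lemma translation_origin v : translation T o v o = v.
Proof. by case: (translation_spec v). Qed.

Lemma translationE s : s \in T -> translation T o (s o) = s.
Proof.
by move=> sT; apply: (@regular_inj o); rewrite ?translation_mem ?translation_origin.
Qed.

Lemma box_imager x s : s \in T -> box T o x (s o) = s x.
Proof. by move=> sT; rewrite /box translationE. Qed.

Lemma boxx0 x : box T o x o = x.
Proof. by rewrite -{2}[o]perm1 box_imager ?group1 // perm1. Qed.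

Hypothesis cTT : abelian T.

Lemma boxC : commutative (box T o).
Proof.
move=> x y; have [s sT <-] := regular_trans o x.
have [t tT <-] := regular_trans o y.
by rewrite !box_imager // -!permM (centsP cTT _ sT _ tT).
Qed.

Lemma box_injr x : injective (box T o x).
Proof. by move=> y z; rewrite ![box T o x _]boxC; apply: perm_inj. Qed.

Lemma box_op_inv s : s \in T -> op_inv (box T o) o (s o) = s^-1 o.
Proof.
move=> sT; apply: (@box_injr (s o)); rewrite box_imager ?groupV // permK.
rewrite /op_inv; case: pickP => [z /eqP -> //|/(_ (s^-1 o))].
by rewrite box_imager ?groupV // permK eqxx.
Qed.

Lemma box_invr x : box T o x (op_inv (box T o) o x) = o.
Proof.
have [s sT <-] := regular_trans o x.
by rewrite box_op_inv // box_imager ?groupV // permK.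
Qed.

End RegularGroup.

(** * Derivatives of maps that normalise another regular group *)

Section TwoRegularGroups.
Local Open Scope group_scope.
Variables (X : finType) (o : X) (N T : {group {perm X}}).
Hypotheses (regN : regular N) (regT : regular T).
Hypotheses (cNN : abelian N) (cTT : abelian T) (nNT : T \subset 'N(N)).

(** The images of [o] under [s * t] and [t * s] agree. Replacing [s] by [theta]
    and [t] by [n] at [o] turns them into [(n * theta ^ t) o] and
    [(theta * n ^ s) o], and an element of [N] is determined by its value
    at [o]. *)
Lemma commg_swap theta n s t : theta \in N -> n \in N -> s \in T -> t \in T ->
  theta o = s o -> n o = t o -> [~ theta, t] = [~ n, s].
Proof.
move=> thN nN sT tT ths nt; have nT u : u \in T -> {in N, forall x, x ^ u \in N}.
  by move=> uT x xN; rewrite memJ_norm ?(subsetP nNT).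
suff E : n * theta ^ t = theta * n ^ s.
  rewrite !commgEl; apply: (mulgI n); rewrite mulKVg.
  by rewrite mulgA (centsP cNN _ nN) ?groupV // -mulgA E mulKg.
apply: (regular_inj regN (x := o)) => /=.
- by rewrite groupM // nT.
- by rewrite groupM // nT.
rewrite (permM n) (permM theta) nt ths -(permM t) -(permM s) -!conjgC.
by rewrite (permM theta) (permM n) nt ths -!permM (centsP cTT _ sT _ tT).
Qed.

(** By [commg_swap] these commutators are the values on [N] of the homomorphism
    [n |-> [~ n, s]], where [s] in [T] agrees with [theta] at [o]. *)
Lemma group_set_commutators theta : theta \in N ->
  group_set [set [~ theta, t] | t in T].
Proof.
move=> thN; have [s sT so] := regular_trans regT o (theta o).
have nN n : n \in N -> [~ n, s] \in N.
  by move=> nN; rewrite commgEl groupM ?groupV // memJ_norm ?(subsetP nNT).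
have swap t : t \in T -> exists2 n, n \in N & [~ theta, t] = [~ n, s].
  move=> tT; have [n nN' no] := regular_trans regN o (t o).
  by exists n => //; apply: commg_swap.
apply/group_setP; split=> [|_ _ /imsetP[t1 t1T ->] /imsetP[t2 t2T ->]].
  by apply/imsetP; exists 1; rewrite ?group1 // commg1.
have [n1 n1N ->] := swap _ t1T; have [n2 n2N ->] := swap _ t2T.
have [t tT to] := regular_trans regT o ((n1 * n2) o).
apply/imsetP; exists t => //; rewrite (@commg_swap theta (n1 * n2) s t) ?groupM //.
by rewrite commMgJ (conjgE [~ n1, s]) (centsP cNN _ (nN _ n1N) _ n2N) mulKg.
Qed.

(** The derivative of the translation [theta] along [T]: with [y] the image of
    [o] under [t^-1], the difference is the image of [o] under [theta ^ t].
    Since [theta ^ t] is [theta * [~ theta, t]], these images form the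
    translate by [theta] of the orbit of [o] under the subgroup of
    commutators, and that orbit is also a subgroup for the operation of [T]
    because [T] normalises the commutators. *)
Lemma derivative_translation_coset theta : theta \in N ->
  op_coset (box T o) o
    [set box T o (theta y) (op_inv (box T o) o y) | y : X].
Proof.
move=> thN; set D := Group (group_set_commutators thN).
have DN : D \subset N.
  apply/subsetP => _ /imsetP[t tT ->].
  by rewrite commgEl groupM ?groupV // memJ_norm ?(subsetP nNT).
(* On the values [[~ n, s]] conjugation by [t] acts through [n] alone, as [t]
   commutes with [s]. *)
have DT d t : d \in D -> t \in T -> d ^ t \in D.
  case/imsetP=> u uT -> tT; have [s sT so] := regular_trans regT o (theta o).
  have [n nN no] := regular_trans regN o (u o).
  rewrite (@commg_swap theta n s u) //.
  rewrite conjRg [s ^ t]conjgE (centsP cTT _ sT _ tT) mulKg.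
  have ntN : n ^ t \in N by rewrite memJ_norm ?(subsetP nNT).
  have [v vT vo] := regular_trans regT o ((n ^ t) o).
  by rewrite -(commg_swap (theta := theta) (t := v)) //; apply: imset_f.
pose U := [set t in T | t o \in [set d o | d : {perm X} in D]].
have gU : group_set U.
  apply/group_setP; split=> [|t1 t2].
    by rewrite inE group1; apply/imsetP; exists 1; rewrite ?group1.
  rewrite !inE => /andP[t1T /imsetP[d1 d1D E1]] /andP[t2T /imsetP[d2 d2D E2]].
  rewrite groupM //=; apply/imsetP; exists (d2 * d1 ^ t2).
    by apply: (@groupM _ D); last exact: DT.
  by rewrite (permM t1) E1 -(permM d1) conjgC (permM t2) E2 -(permM d2).
pose H := [set (t : {perm X}) o | t in Group gU].
have [s sT so] := regular_trans regT o (theta o).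
have UT t : t \in U -> t \in T by rewrite inE => /andP[].
have HD : H = [set d o | d : {perm X} in D].
  apply/setP=> x; apply/imsetP/idP => [[t + ->]|/imsetP[d dD ->]].
    by rewrite inE => /andP[].
  have [t tT to] := regular_trans regT o (d o).
  by exists t => //; rewrite inE tT to imset_f.
have cardH : #|H| = #|D|.
  by rewrite HD card_in_imset //; apply: sub_in2 (regular_inj regN (x := o));
    apply/subsetP.
exists H, (s o); split.
  split; first by apply/imsetP; exists 1; rewrite ?group1 ?perm1.
    move=> _ _ /imsetP[t1 t1U ->] /imsetP[t2 t2U ->].
    by rewrite box_imager ?UT // -permM imset_f ?groupM.
  by move=> _ /imsetP[t tU ->]; rewrite box_op_inv ?UT // imset_f ?groupV.
have -> : [set box T o (theta y) (op_inv (box T o) o y) | y : X]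
        = [set (theta * d) o | d in D].
  apply/setP=> x; apply/imsetP/imsetP => [[y _ ->]|[_ /imsetP[t tT ->] ->]].
    have [t tT <-] := regular_trans regT o y.
    exists [~ theta, t^-1]; first by rewrite imset_f ?groupV.
    rewrite box_op_inv // box_imager ?groupV //.
    by rewrite commgEl mulKVg conjgE invgK !permM.
  exists (t^-1 o) => //; rewrite box_op_inv ?groupV // invgK box_imager //.
  by rewrite commgEl mulKVg conjgE !permM.
(* One inclusion is enough, as both sets have the size of [D]. *)
apply/esym/eqP; rewrite eqEcard; apply/andP; split.
  apply/subsetP=> _ /imsetP[_ /imsetP[t tU ->] ->].
  move: (tU); rewrite inE => /andP[tT /imsetP[d dD td]].
  apply/imsetP; exists (d * [~ theta, t]).
    by apply: (@groupM _ D); last exact: imset_f.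
  rewrite box_imager // so -permM conjgC permM td -permM.
  have -> : theta ^ t = theta * [~ theta, t] by rewrite commgEl mulKVg.
  by rewrite !mulgA (centsP cNN _ (subsetP DN _ dD) _ thN).
rewrite [leqRHS]card_imset; last exact: box_injr.
by rewrite cardH leq_imset_card.
Qed.

(** Some nontrivial [tau] in [N] lies in [T] as well: the [q]-group [N * T] has a
    nontrivial central element in its normal subgroup [N], and [T] is
    self-centralising. With [a] the image of [o] under [tau],
    adding [a] is applying [tau], which [rho] turns into applying
    [tau ^ rho], again an element of [N]. *)
Lemma normaliser_derivative_coset (q : nat) (rho : {perm X}) :
    q.-group N -> N :!=: 1 -> rho \in 'N(N) ->
  exists2 a, a != o & op_coset (box T o) o
    [set box T o (rho (box T o x a)) (op_inv (box T o) o (rho x)) | x : X].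
Proof.
move=> qN ntN nNrho.
have qT : q.-group T by rewrite /pgroup (card_regular regT o) -(card_regular regN o).
have qG : q.-group (T <*> N) by rewrite /= norm_joinEl // pgroupM qT.
have nNG : N <| T <*> N by rewrite /normal joing_subr join_subG nNT normG.
have /trivgPn[tau /setIP[tauN /setIP[_ cGtau]] nt_tau] :=
  meet_center_nil (pgroup_nil qG) nNG ntN.
have tauT : tau \in T.
  apply: (subsetP (regular_abelian_self_centralising regT o cTT)).
  exact: subsetP (centS (joing_subl T N)) _ cGtau.
exists (tau o).
  apply: contra nt_tau => /eqP tau_o; apply/eqP.
  by apply: (regular_inj regT (x := o)); rewrite ?group1 ?perm1.
have -> : [set box T o (rho (box T o x (tau o))) (op_inv (box T o) o (rho x)) | x : X]
  = [set box T o ((tau ^ rho) y) (op_inv (box T o) o y) | y : X].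
  apply/setP=> z; apply/imsetP/imsetP => -[x _ ->].
    by exists (rho x); rewrite // box_imager // -!permM -conjgC.
  by exists (rho^-1 x); rewrite // box_imager // permKV conjgE !permM.
by apply: derivative_translation_coset; rewrite memJ_norm.
Qed.

End TwoRegularGroups.

(** * Cosets and homomorphisms of operations *)

Lemma op_coset_image (X Y : finType) (op : X -> X -> X) (e : X)
    (op' : Y -> Y -> Y) (e' : Y) (f : X -> Y) (S : {set X}) :
    {morph f : x y / op x y >-> op' x y} -> f e = e' ->
    (forall x, f (op_inv op e x) = op_inv op' e' (f x)) ->
  op_coset op e S -> op_coset op' e' (f @: S).
Proof.
move=> fM fe fV [H [a [[He HM HV] ->]]]; exists (f @: H), (f a); split.
  split; first by rewrite -fe imset_f.
    by move=> _ _ /imsetP[x xH ->] /imsetP[y yH ->]; rewrite -fM imset_f // HM.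
  by move=> _ /imsetP[x xH ->]; rewrite -fV imset_f // HV.
by rewrite -!imset_comp; apply: eq_imset => x /=; rewrite fM.
Qed.

Section BoxMorphism.
Variables (X Y : finType) (T : {group {perm X}}) (U : {group {perm Y}}).
Variables (o : X) (e : Y) (f : X -> Y).
Hypotheses (regT : regular T) (regU : regular U) (cUU : abelian U).
Hypothesis cTT : abelian T.
Hypothesis fM : {morph f : x y / box T o x y >-> box U e x y}.

Lemma box_morph_origin : f o = e.
Proof.
by apply: (box_injr regU (o := e) cUU (x := f o)); rewrite -fM !boxx0.
Qed.

Lemma box_morph_inv x : f (op_inv (box T o) o x) = op_inv (box U e) e (f x).
Proof.
apply: (box_injr regU (o := e) cUU (x := f x)).
by rewrite -fM !box_invr // box_morph_origin.
Qed.

End BoxMorphism.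

(** * Translations of a vector space structure *)

Section AffineGroup.
Variables (p : nat) (X : finType) (c : GRing.Lmodule 'F_p X).
Let L : lmodType 'F_p := GRing.Lmodule.Pack c.

Fact lmod_shift_inj (v : L) : injective (fun x : X => ((x : L) + v : L) : X).
Proof. exact: (@addIr L v). Qed.

Definition lmod_shift (v : X) : {perm X} := perm (@lmod_shift_inj v).

Lemma lmod_shiftE (v x : X) : lmod_shift v x = ((x : L) + (v : L) : L).
Proof. by rewrite permE. Qed.

Fact lmod_shifts_group_set : group_set [set lmod_shift v | v : X].
Proof.
apply/group_setP; split=> [|_ _ /imsetP[u _ ->] /imsetP[v _ ->]].
  apply/imsetP; exists (0 : L) => //.
  by apply/permP => x; rewrite perm1 lmod_shiftE addr0.
apply/imsetP; exists ((u : L) + (v : L) : L) => //.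
by apply/permP => x; rewrite permM !lmod_shiftE addrA.
Qed.

Definition lmod_shifts : {group {perm X}} := Group lmod_shifts_group_set.

Lemma lmod_shifts_regular : regular lmod_shifts.
Proof.
split.
  apply/imsetP; exists (0 : L); rewrite ?inE //; apply/esym/setP=> v; rewrite inE.
  apply/orbitP; exists (lmod_shift v); first exact: imset_f.
  by rewrite /= apermE lmod_shiftE add0r.
move=> x; apply/eqP; rewrite eqEsubset sub1G andbT; apply/subsetP=> s.
rewrite inE => /andP[/imsetP[v _ ->] /astab1P].
rewrite /= apermE lmod_shiftE => /(canRL (addKr (x : L))); rewrite addNr => v0.
by apply/set1P/permP => y; rewrite perm1 lmod_shiftE v0 addr0.
Qed.

Lemma lmod_shifts_abelian : abelian lmod_shifts.
Proof.
apply/centsP=> _ /imsetP[u _ ->] _ /imsetP[v _ ->].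
by apply/permP => x; rewrite !permM !lmod_shiftE addrAC.
Qed.

(** An affine map with linear part [g] conjugates the shift by [v] to the shift
    by [g v]. *)
Lemma AGL_norm_shifts : AGL c \subset 'N(lmod_shifts)%g.
Proof.
apply/subsetP=> s; rewrite inE => /asboolP[g [w [_ sE]]].
rewrite inE; apply/subsetP=> _ /imsetP[_ /imsetP[v _ ->] ->].
apply/imsetP; exists (g v) => //; apply/permP=> x.
rewrite conjgE !permM.
have -> : x = s ((s^-1)%g x) by rewrite permKV.
rewrite permK; move: ((s^-1)%g x) => y; rewrite [RHS]lmod_shiftE lmod_shiftE.
by rewrite !sE linearD addrAC.
Qed.

End AffineGroup.

(** * The key action and its components *)

Section Components.
Variables (p d n m : nat) (V_ : 'I_n -> {vspace 'rV['F_p]_d}).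
Hypothesis V_dec : decomposition V_ m.

Lemma componentK v : of_components (fun i => component V_ i v) = v.
Proof.
have [_ fullV _] := V_dec.
rewrite /of_components /component.
under eq_bigr => i _ do rewrite vsprojK ?memv_sum_pi //.
by rewrite sumv_pi_sum // fullV memvf.
Qed.

Lemma of_componentsK (w : forall i, subvs_of (V_ i)) i :
  component V_ i (of_components w) = w i.
Proof.
have [dirV _ _] := V_dec.
have /eqP := componentK (of_components w); rewrite {1 3}/of_components.
rewrite (directv_sum_unique dirV) => [|j _|j _]; try exact: subvsP.
by move=> /forallP/(_ i)/eqP/val_inj.
Qed.

Lemma component_inj v w :
  (forall i, component V_ i v = component V_ i w) -> v = w.
Proof.
by move=> vw; rewrite -(componentK v) -(componentK w); apply: eq_bigr => i _; rewrite vw.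
Qed.

Lemma component_surj i (x : subvs_of (V_ i)) : exists v, component V_ i v = x.
Proof.
exists (of_components (dfwith (fun j => 0 : subvs_of (V_ j)) x)).
by rewrite of_componentsK dfwith_in.
Qed.

Lemma component0 i : component V_ i 0 = 0.
Proof. by rewrite /component !linear0. Qed.

Variable T_ : forall i, {group {perm subvs_of (V_ i)}}.
Hypothesis regT : forall i, regular (T_ i).

Fact componentwise_inj (t : forall i, {perm subvs_of (V_ i)}) :
  injective (componentwise (fun i => t i)).
Proof.
move=> v w vw; apply: component_inj => i; apply: (@perm_inj _ (t i)).
by have := congr1 (component V_ i) vw; rewrite !of_componentsK.
Qed.

Hypothesis gT : group_set (prod_group T_).

Lemma prod_group_regular : regular (prod_group T_).
Proof.
split.
  apply/imsetP; exists 0; rewrite ?inE //; apply/esym/setP=> v; rewrite inE.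
  apply/imsetP; pose t i := translation (T_ i) 0 (component V_ i v).
  exists (perm (@componentwise_inj t)).
    rewrite inE; apply/asboolP; exists t; split=> [i|w]; last by rewrite permE.
    exact: translation_mem.
  rewrite /= apermE permE; apply: component_inj => i.
  by rewrite of_componentsK component0 translation_origin.
move=> x; apply/setP=> s; apply/idP/set1P => [|->]; last first.
  exact: (group1 [group of 'C_(Group gT)[x | 'P]]%g).
rewrite inE => /andP[]; rewrite inE => /asboolP[t [tT sE]] /astab1P.
rewrite /= apermE => sx; apply/permP=> v; rewrite perm1 sE.
apply: component_inj => i; rewrite of_componentsK.
suff -> : t i = 1%g by rewrite perm1.
apply: (regular_inj (regT i) (x := component V_ i x)) => //=.
by rewrite perm1 -{2}sx sE of_componentsK.
Qed.

(** The operation induced by the regular group [prod_group] on the whole space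
    is the componentwise one, so all results on regular groups apply to
    [boxV]. *)
Lemma box_prod_group w v : box (prod_group T_) 0 w v = boxV T_ w v.
Proof.
have [+ E] := translation_spec (T := Group gT) prod_group_regular 0 v.
rewrite inE => /asboolP[t [tT sE]].
rewrite /box sE; apply: component_inj => i; rewrite !of_componentsK /boxi.
by rewrite -E sE of_componentsK component0 (box_imager (regT i)) ?tT.
Qed.

End Components.

(** * The theorem *)

Section Cipher.
Variables (p d n m : nat) (V_ : 'I_n -> {vspace 'rV['F_p]_d}).
Hypothesis V_dec : decomposition V_ m.
Variable T_ : forall i, {group {perm subvs_of (V_ i)}}.
Variables (K : Type) (C : block_cipher K 'rV['F_p]_d) (rb : rb_cipher T_ C).
Variable h0 : 'I_(rounds C).
Hypothesis h0_surj : forall v : 'rV['F_p]_d, exists k : K, key_sched rb k h0 = v.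

Lemma Gamma_round_sub_inf : Gamma_round h0 \subset Gamma_inf C.
Proof.
apply: genS; apply/subsetP => s; rewrite !inE => /asboolP[k ->].
by apply/asboolP; exists k, h0.
Qed.

(** The key schedule reaches the key [0], whose key action is trivial. *)
Lemma keyless_round_in_Gamma :
  (gamma rb h0 * lambda rb h0)%g \in Gamma_round h0.
Proof.
have [_ regT gT _ _] := rb_key_action rb.
have [k k0] := h0_surj 0; apply: mem_gen; rewrite inE; apply/asboolP; exists k.
apply/permP => x; rewrite permM (rb_round rb) k0 -(box_prod_group V_dec regT gT).
by rewrite (boxx0 (T := Group gT) (prod_group_regular V_dec regT gT)).
Qed.

(** Two round functions of the same round differ by a key action only. *)
Lemma key_action_sub_Gamma : prod_group T_ \subset Gamma_round h0.
Proof.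
have [_ regT gT _ _] := rb_key_action rb.
have regP := prod_group_regular V_dec regT gT.
apply/subsetP => s sT; have [k ks] := h0_surj (s 0).
rewrite -(groupMl _ keyless_round_in_Gamma).
apply: mem_gen; rewrite inE; apply/asboolP; exists k.
apply/permP => x; rewrite !permM (rb_round rb) ks -(box_prod_group V_dec regT gT).
by rewrite (box_imager (T := Group gT) regP).
Qed.

(** Undoing [lambda] and then taking a component is a homomorphism onto the
    operation of a brick; it maps the derivative of the keyless round to the
    derivative of the brick. *)
Lemma brick_derivative_coset (a : 'rV['F_p]_d) (i : 'I_n) :
    let rho := (gamma rb h0 * lambda rb h0)%g in
    op_coset (boxV T_) 0
      [set boxV T_ (rho (boxV T_ x a)) (op_inv (boxV T_) 0 (rho x)) | x : 'rV_d] ->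
  op_coset (boxi T_ (i := i)) 0
    [set boxi T_ (brick rb h0 i (boxi T_ x (component V_ i a)))
       (op_inv (boxi T_ (i := i)) 0 (brick rb h0 i x)) | x : subvs_of (V_ i)].
Proof.
have [cT regT gT cP _] := rb_key_action rb.
have regP := prod_group_regular V_dec regT gT.
move=> rho; have -> : boxV T_ = box (prod_group T_) 0.
  by apply: funext => w; apply: funext => v; rewrite (box_prod_group V_dec regT gT).
pose f v := component V_ i ((lambda rb h0)^-1%g v).
have fM : {morph f : x y / box (prod_group T_) 0 x y >-> box (T_ i) 0 x y}.
  move=> x y; rewrite (box_prod_group V_dec regT gT) /f.
  rewrite -{1}[x](permKV (lambda rb h0)) -{1}[y](permKV (lambda rb h0)).
  by rewrite -(rb_automorphism rb) permK (of_componentsK V_dec).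
have f0 := box_morph_origin (T := Group gT) regP (regT i) (cT i) fM.
have fV := box_morph_inv (T := Group gT) regP (regT i) (cT i) cP fM.
have f_rho x : f (rho x) = brick rb h0 i (component V_ i x).
  by rewrite /f permM permK (rb_bricklayer rb) (of_componentsK V_dec).
move=> /(op_coset_image fM f0 fV); congr op_coset.
rewrite -imset_comp; apply/setP=> z; apply/imsetP/imsetP => -[x _ ->].
  exists (component V_ i x) => //=; rewrite fM fV !f_rho.
  by rewrite (box_prod_group V_dec regT gT) (of_componentsK V_dec).
have [v <-] := component_surj V_dec x.
exists v => //=; rewrite fM fV !f_rho.
by rewrite (box_prod_group V_dec regT gT) (of_componentsK V_dec).
Qed.

End Cipher.

Theorem theorem3p4 (p d n m : nat) (p_prime : prime p)
    (n_gt1 : (1 < n)%N) (m_gt1 : (1 < m)%N)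
    (V_ : 'I_n -> {vspace 'rV['F_p]_d})
    (V_dec : decomposition V_ m)
    (T_ : forall i, {group {perm subvs_of (V_ i)}})
    (K : Type) (C : block_cipher K 'rV['F_p]_d)
    (rb : rb_cipher T_ C)
    (h0 : 'I_(rounds C))
    (h0_surj : forall v : 'rV['F_p]_d, exists k : K, key_sched rb k h0 = v)
    (AC : forall i : 'I_n, anti_crooked (boxi T_ (i := i)) 0 (brick rb h0 i)) :
  forall c : GRing.Lmodule 'F_p 'rV['F_p]_d,
    ~ (Gamma_round h0 \subset AGL c) /\ ~ (Gamma_inf C \subset AGL c).
Proof.
move=> c; suff main : ~ (Gamma_round h0 \subset AGL c).
  by split=> // /(subset_trans (Gamma_round_sub_inf h0)).
move=> sGA; have [cT regT gT cP _] := rb_key_action rb.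
have regP := prod_group_regular V_dec regT gT.
have nNG := subset_trans sGA (AGL_norm_shifts c).
have regN := lmod_shifts_regular c; have cNN := lmod_shifts_abelian c.
have cardN : #|lmod_shifts c| = (p ^ d)%N.
  by rewrite (card_regular regN 0) card_mx card_Fp // mul1n.
have d_gt0 : (0 < d)%N.
  have [_ _ /(_ (Ordinal (ltnW n_gt1))) dimV] := V_dec.
  apply: leq_trans (ltnW m_gt1) _; rewrite -dimV.
  by have := dimvS (subvf (V_ (Ordinal (ltnW n_gt1)))); rewrite dimvf /dim /= mul1n.
have pN : (p.-group (lmod_shifts c))%g by rewrite /pgroup cardN pnatX pnat_id.
have ntN : (lmod_shifts c :!=: 1)%g.
  by rewrite -cardG_gt1 cardN -(expn0 p) ltn_exp2l // prime_gt1.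
have nNT := subset_trans (key_action_sub_Gamma V_dec h0_surj) nNG.
have nNrho := subsetP nNG _ (keyless_round_in_Gamma V_dec h0_surj).
have [a nz_a] := normaliser_derivative_coset (T := Group gT) 0
  regN regP cNN cP nNT pN ntN nNrho.
have -> : box (Group gT) 0 = boxV T_.
  by apply: funext => w; apply: funext => v; rewrite -(box_prod_group V_dec regT gT).
have [i nz_ai] : exists i, component V_ i a != 0.
  apply/existsP; apply: contraNT nz_a; rewrite negb_exists => /forallP a0.
  apply/eqP/(component_inj V_dec) => i; rewrite component0.
  by apply/eqP; have := a0 i; rewrite negbK.
by move=> /(brick_derivative_coset V_dec i)/(AC i _ nz_ai).
Qed.
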